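(* Let $n$ be a positive integer. For every $i=1,\ldots,n$ the relation $\sigma_{[i]}$ is a congruence on the semigroup $\mathscr{IO}_{\infty}(\mathbb{Z}^n_{\mathrm{lex}})$.
   Context: $L_n=\{1,\ldots,n\}$ with its usual order; $L_n\times_{\mathrm{lex}}\mathbb{Z}$ is $L_n\times\mathbb{Z}$ with the lexicographic order: $(i,m)\leqslant(j,l)$ iff $i<j$, or $i=j$ and $m\le l$. $\mathscr{IO}_{\infty}(\mathbb{Z}^n_{\mathrm{lex}})$ is the inverse monoid of all injective partial maps $\alpha$ from $L_n\times\mathbb{Z}$ to itself that are monotone ($x\leqslant y$ in $\operatorname{dom}\alpha$ implies $(x)\alpha\leqslant(y)\alpha$) and such that both $\operatorname{dom}\alpha$ and $\operatorname{ran}\alpha$ have finite complement in $L_n\times\mathbb{Z}$; the operation is composition of partial maps written on the right, $(x)(\alpha\beta)=((x)\alpha)\beta$. $\mathscr{IO}_{\infty}(\mathbb{Z})$ is the analogous monoid of injective monotone partial selfmaps of $\mathbb{Z}$ (usual order) with cofinite domain and image. Every element of $\mathscr{IO}_{\infty}(\mathbb{Z}^n_{\mathrm{lex}})$ preserves the first coordinate, so $\mathscr{IO}_{\infty}(\mathbb{Z}^n_{\mathrm{lex}})$ is identified with the direct power $(\mathscr{IO}_{\infty}(\mathbb{Z}))^n$ by $\alpha\leftrightarrow(\alpha_1,\ldots,\alpha_n)$, where $(i,k)\alpha=(i,(k)\alpha_i)$. For $\varepsilon\in\mathscr{IO}_{\infty}(\mathbb{Z})$ let $\varepsilon_i^\circ$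 denote the element of $(\mathscr{IO}_{\infty}(\mathbb{Z}))^n$ whose $i$-th coordinate is $\varepsilon$ and whose other coordinates are the identity. The relation $\sigma_{[i]}$ is defined by: $\alpha\,\sigma_{[i]}\,\beta$ iff there exists an idempotent $\varepsilon\in\mathscr{IO}_{\infty}(\mathbb{Z})$ such that $\alpha\varepsilon_i^\circ=\beta\varepsilon_i^\circ$. *)

(* Defs.v *)
From Corelib Require Export RelationClasses.
From HB Require Import structures.
From mathcomp Require Export all_boot all_order ssralg ssrnum ssrint.
From mathcomp Require Export boolp classical_sets cardinality.

Set Implicit Arguments.
Unset Strict Implicit.
Unset Printing Implicit Defensive.

Import Order.TTheory.

Local Open Scope classical_set_scope.
Local Open Scope order_scope.
Local Open Scope group_scope.

Definition congruence (S : semigroupType) (R : S -> S -> Prop) : Prop :=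
  [/\ Equivalence R,
      forall c a b : S, R a b -> R (c * a) (c * b) &
      forall c a b : S, R a b -> R (a * c) (b * c)].

Section PartialMaps.
Variables (d : Order.disp_t) (T : porderType d).
Implicit Types f g : T -> option T.

Definition pdom f : set T := [set x | exists y, f x = Some y].
Definition pran f : set T := [set y | exists x, f x = Some y].

Definition pinjective f : Prop :=
  forall x y z, f x = Some z -> f y = Some z -> x = y.

Definition pmonotone f : Prop :=
  forall x y x' y', f x = Some x' -> f y = Some y' -> x <= y -> x' <= y'.

(* The product of partial maps is written on the right: f is applied first. *)
Definition pcomp f g : T -> option T := fun x => obind g (f x).

Record IOinf := MkIOinf {
  pmap_of :> T -> option T;
  IOinf_inj : pinjective pmap_of;
  IOinf_mono : pmonotone pmap_of;
  IOinf_dom : cofinite_set (pdom pmap_of);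
  IOinf_ran : cofinite_set (pran pmap_of) }.

Lemma IOinf_ext (a b : IOinf) : pmap_of a =1 pmap_of b -> a = b.
Proof.
case: a b => [f f1 f2 f3 f4] [g g1 g2 g3 g4] /= /funext eq_fg.
by subst g; congr MkIOinf; apply: Prop_irrelevance.
Qed.

Lemma pcomp_SomeP f g x z :
  pcomp f g x = Some z <-> exists2 y, f x = Some y & g y = Some z.
Proof.
rewrite /pcomp; split; last by case=> y -> /=.
by case: (f x) => [y|] //= gy; exists y.
Qed.

Section Product.
Variables a b : IOinf.

Lemma pcomp_inj : pinjective (pcomp a b).
Proof.
move=> x y z /pcomp_SomeP[x' ax bx] /pcomp_SomeP[y' ay bY].
have exy := IOinf_inj bx bY; rewrite exy in ax.
exact: IOinf_inj ax ay.
Qed.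

Lemma pcomp_mono : pmonotone (pcomp a b).
Proof.
move=> x y x' y' /pcomp_SomeP[u ax bx] /pcomp_SomeP[v ay bY] le_xy.
exact: IOinf_mono bx bY (IOinf_mono ax ay le_xy).
Qed.

Lemma pcomp_dom : cofinite_set (pdom (pcomp a b)).
Proof.
pose B := pmap_of a @^-1` (Some @` (~` pdom b)).
apply: (@sub_finite_set _ _ (~` pdom a `|` B)) => [x Nx|].
  case ax: (a x) => [y|]; last by left=> -[y]; rewrite ax.
  right; exists y => // -[z bz].
  by apply: Nx; exists z; apply/pcomp_SomeP; exists y.
rewrite finite_setU; split; first exact: IOinf_dom.
apply: finite_preimage; last by apply: finite_image; exact: IOinf_dom.
move=> x y /set_mem[z _ ax] /set_mem[t _ ay] exy.
by rewrite -ax in exy; apply: (IOinf_inj (esym ax)); rewrite -exy.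
Qed.

Lemma pcomp_ran : cofinite_set (pran (pcomp a b)).
Proof.
pose B := Some @^-1` (pmap_of b @` (~` pran a)).
apply: (@sub_finite_set _ _ (~` pran b `|` B)) => [z Nz|].
  have [[y bz]|?] := pselect (pran b z); last by left.
  right; exists y => // -[x ax].
  by apply: Nz; exists x; apply/pcomp_SomeP; exists y.
rewrite finite_setU; split; first exact: IOinf_ran.
apply: finite_preimage; last by apply: finite_image; exact: IOinf_ran.
by move=> x y _ _ [].
Qed.

Definition IOinf_mul : IOinf :=
  MkIOinf pcomp_inj pcomp_mono pcomp_dom pcomp_ran.

End Product.

Fact Some_inj : pinjective (@Some T). Proof. by move=> x y z [->] [->]. Qed.

Fact Some_mono : pmonotone (@Some T).
Proof. by move=> x y x' y' [<-] [<-]. Qed.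

Fact Some_dom : cofinite_set (pdom (@Some T)).
Proof.
rewrite (_ : pdom _ = setT) ?setCT//.
by apply/seteqP; split=> // x _; exists x.
Qed.

Fact Some_ran : cofinite_set (pran (@Some T)).
Proof.
rewrite (_ : pran _ = setT) ?setCT//.
by apply/seteqP; split=> // x _; exists x.
Qed.

Definition IOinf_one : IOinf := MkIOinf Some_inj Some_mono Some_dom Some_ran.

Lemma IOinf_mulA : associative IOinf_mul.
Proof.
move=> a b c; apply: IOinf_ext => x /=; rewrite /pcomp /=.
by case: (a x).
Qed.

Lemma IOinf_mul1 : left_id IOinf_one IOinf_mul.
Proof. by move=> a; apply: IOinf_ext. Qed.

Lemma IOinf_mulr1 : right_id IOinf_one IOinf_mul.
Proof. by move=> a; apply: IOinf_ext => x /=; rewrite /pcomp; case: (a x). Qed.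

HB.instance Definition _ := gen_eqMixin IOinf.
HB.instance Definition _ := gen_choiceMixin IOinf.
HB.instance Definition _ :=
  isMonoid.Build IOinf IOinf_mulA IOinf_mul1 IOinf_mulr1.

End PartialMaps.

(* 'I_n, i.e. {0, ..., n - 1}, plays the role of L_n = {1, ..., n}. *)
Notation IO_Z := (IOinf int).
Notation IO_Zlex n := (IOinf ('I_n *l int)%type).

Section DirectPower.
Variable n : nat.

Definition of_power_map (a : 'I_n -> IO_Z) (x : 'I_n *l int) :
    option ('I_n *l int) :=
  omap (fun k => (x.1, k)) (a x.1 x.2).

Section OfPower.
Variable a : 'I_n -> IO_Z.

Lemma of_power_SomeP (x y : 'I_n *l int) :
  of_power_map a x = Some y <-> x.1 = y.1 /\ a x.1 x.2 = Some y.2.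
Proof.
case: x y => [i k] [j l]; rewrite /of_power_map /=; split.
  by case: (a i k) => //= m [-> ->].
by case=> -> ->.
Qed.

Lemma of_power_inj : pinjective (of_power_map a).
Proof.
move=> [i k] [j l] [p m] /of_power_SomeP[/= -> ak] /of_power_SomeP[/= -> al].
by rewrite (IOinf_inj ak al).
Qed.

Lemma of_power_mono : pmonotone (of_power_map a).
Proof.
move=> [i k] [j l] [i' k'] [j' l'].
move=> /of_power_SomeP[/= <- ak] /of_power_SomeP[/= <- al].
rewrite !leEprodlexi /= => /andP[le_ij /implyP le_kl].
rewrite le_ij; apply/implyP=> le_ji.
have eij : i = j by apply/le_anti/andP.
by subst j; exact: IOinf_mono ak al (le_kl le_ji).
Qed.

Lemma finite_power (A : 'I_n -> set int) :
  (forall i, finite_set (A i)) ->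
  finite_set [set x : 'I_n *l int | A x.1 x.2].
Proof.
move=> finA.
apply: (@sub_finite_set _ _
    (\bigcup_(i in [set: 'I_n]) ((fun k => (i, k) : 'I_n *l int) @` A i))).
  by move=> [i k] /= Ak; exists i => //; exists k.
by apply: bigcup_finite => [|i _]; [exact: finite_finset | exact: finite_image].
Qed.

Lemma of_power_dom : cofinite_set (pdom (of_power_map a)).
Proof.
apply: sub_finite_set (finite_power (fun i => IOinf_dom (a i))).
move=> x Nx [k ak]; apply: Nx; exists (x.1, k).
by apply/of_power_SomeP.
Qed.

Lemma of_power_ran : cofinite_set (pran (of_power_map a)).
Proof.
apply: sub_finite_set (finite_power (fun i => IOinf_ran (a i))).
move=> x Nx [k ak]; apply: Nx; exists (x.1, k).
by apply/of_power_SomeP.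
Qed.

End OfPower.

(* The identification of the direct power of IO_Z with IO_Zlex n:
   (i, k) is sent to (i, (k) a_i). *)
Definition of_power (a : {ffun 'I_n -> IO_Z}) : IO_Zlex n :=
  MkIOinf (@of_power_inj a) (@of_power_mono a)
    (@of_power_dom a) (@of_power_ran a).

Definition circ (i : 'I_n) (e : IO_Z) : {ffun 'I_n -> IO_Z} :=
  [ffun j => if j == i then e else 1].

Definition sigma (i : 'I_n) (a b : IO_Zlex n) : Prop :=
  exists2 e : IO_Z, e * e = e &
    a * of_power (circ i e) = b * of_power (circ i e).

End DirectPower.

(* Main.v *)
Require Import Defs.
From mathcomp Require Import zify.

(** The relation [sigma i] identifies two maps when they differ only in values
    lying in a finite subset of row [i]. In these terms everything is immediate
    except compatibility with multiplication on the right by [c], where the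
    exceptional set has to be replaced by its image under [c]; that image is
    again in row [i] because [c] preserves rows. To see the latter, points in
    different rows have infinitely many points of the domain between them, so
    their images cannot lie in one row; hence [c] strictly increases the row
    index along chains of points in different rows, and since every row meets
    the domain, the index can neither drop nor grow. *)

Set Implicit Arguments.
Unset Strict Implicit.
Unset Printing Implicit Defensive.

Import Order.TTheory GRing.Theory.

Local Open Scope classical_set_scope.
Local Open Scope order_scope.
Local Open Scope group_scope.

Lemma finite_int_interval (u v : int) : finite_set [set w : int | u <= w <= v].
Proof.
apply: (@sub_finite_set _ _ ((fun m : nat => (u + m%:Z)%R) @` `I_(`|v - u|%N.+1))).
  by move=> w /= uwv; exists `|w - u|%N => /=; lia.
exact/finite_image/finite_II.
Qed.

Section PartialIdentity.
Variables (d : Order.disp_t) (T : porderType d).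

Definition pid_off (F : set T) (x : T) : option T :=
  if `[< F x >] then None else Some x.

Lemma pid_off_SomeP (F : set T) x y : pid_off F x = Some y <-> x = y /\ ~ F x.
Proof.
by rewrite /pid_off; case: asboolP => Fx; split=> [[]|[]] // ->.
Qed.

Section Finite.
Variables (F : set T) (finF : finite_set F).

Lemma pid_off_inj : pinjective (pid_off F).
Proof. by move=> x y z /pid_off_SomeP[-> _] /pid_off_SomeP[-> _]. Qed.

Lemma pid_off_mono : pmonotone (pid_off F).
Proof. by move=> x y x' y' /pid_off_SomeP[-> _] /pid_off_SomeP[-> _]. Qed.

Lemma pid_off_dom : cofinite_set (pdom (pid_off F)).
Proof.
apply: sub_finite_set finF => x Nx; apply: contrapT => NFx.
by apply: Nx; exists x; apply/pid_off_SomeP.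
Qed.

Lemma pid_off_ran : cofinite_set (pran (pid_off F)).
Proof.
apply: sub_finite_set finF => x Nx; apply: contrapT => NFx.
by apply: Nx; exists x; apply/pid_off_SomeP.
Qed.

(** Supplies the idempotent with a prescribed finite set removed from its domain, needed to witness
    [sigma]. *)
Definition IOinf_off : IOinf T :=
  MkIOinf pid_off_inj pid_off_mono pid_off_dom pid_off_ran.

Lemma IOinf_off_idem : IOinf_off * IOinf_off = IOinf_off.
Proof.
apply: IOinf_ext => x; rewrite /= /pcomp /pid_off /=.
by case: asboolP => //= Fx; case: asboolP.
Qed.

End Finite.

Lemma IOinf_mul_SomeP (a b : IOinf T) x z :
  (a * b) x = Some z <-> exists2 y, a x = Some y & b y = Some z.
Proof. exact: pcomp_SomeP. Qed.

(** Idempotency gives [e y = Some y], so [x] and [y] have the same image and injectivity applies. *)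
Lemma IOinf_idem_fix (e : IOinf T) x y : e * e = e -> e x = Some y -> x = y.
Proof.
move=> ee ex; move: (ex); rewrite -{1}ee => /IOinf_mul_SomeP[z exz ez].
move: exz ez; rewrite ex => -[<-] ey; exact: IOinf_inj ex ey.
Qed.

Lemma IOinf_eqP (a b : IOinf T) :
  (forall x y, a x = Some y <-> b x = Some y) -> a = b.
Proof.
move=> ab; apply: IOinf_ext => x.
case ax: (a x) => [y|]; first by rewrite (ab x y).1.
by case bx: (b x) => [y|] //; move/ab: bx; rewrite ax.
Qed.

End PartialIdentity.

Section Rows.
Variable n : nat.
Implicit Types (i j p : 'I_n) (c : IO_Zlex n).

Lemma row_ray_not_finite i (k : int) (A : set ('I_n *l int)) :
  finite_set A -> ~ (forall m : nat, A (i, (k + m%:Z)%R)).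
Proof.
move=> finA allA; apply: infinite_nat.
pose g (m : nat) : 'I_n *l int := (i, (k + m%:Z)%R).
rewrite (_ : [set: nat] = g @^-1` A); last first.
  by apply/seteqP; split=> m // _; exact: allA.
by apply: finite_preimage finA => x y _ _ [] /addrI [].
Qed.

Lemma row_meets_dom c i : exists k y, c (i, k) = Some y.
Proof.
apply: contrapT => none; apply: (@row_ray_not_finite i 0 _ (IOinf_dom c)).
by move=> m [y cy]; apply: none; exists (0 + m%:Z)%R, y.
Qed.

Lemma row_lt c i j p q k l u v :
  c (i, k) = Some (p, u) -> c (j, l) = Some (q, v) -> i < j -> p < q.
Proof.
move=> ci cj ij.
have leij m : ((i, m) : 'I_n *l int) <= (j, l).
  by rewrite leEprodlexi /= (ltW ij) leNgt ij.
have := IOinf_mono ci cj (leij k).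
rewrite leEprodlexi /= => /andP[lepq _]; rewrite lt_neqAle lepq andbT.
apply/eqP => epq; subst q.
(* If both images lie in row [p], monotonicity traps the image of the ray from [(i, k)] in the
   finite interval [I]. The ray is then covered by two finite sets: the complement of the domain and
   the preimage of [I]. *)
pose I : set ('I_n *l int) := (fun w => (p, w)) @` [set w | u <= w <= v].
apply: (@row_ray_not_finite i k (~` pdom c `|` pmap_of c @^-1` (Some @` I))).
  rewrite finite_setU; split; first exact: IOinf_dom.
  apply: finite_preimage; last first.
    exact/finite_image/finite_image/finite_int_interval.
  move=> x y /set_mem[z _ cx] /set_mem[t _ cy] exy.
  by rewrite -cx in exy; apply: (IOinf_inj (esym cx)); rewrite -exy.
move=> m; case cm: (c (i, (k + m%:Z)%R)) => [[r w]|]; last first.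
  by left=> -[y]; rewrite cm.
right; rewrite /preimage /= cm; exists (r, w) => //.
have km : ((i, k) : 'I_n *l int) <= (i, (k + m%:Z)%R).
  by rewrite leEprodlexi /= lexx /=; lia.
have := IOinf_mono ci cm km; have := IOinf_mono cm cj (leij _).
rewrite !leEprodlexi /= => /andP[rp /implyP wv] /andP[pr /implyP uw].
have epr : p = r by apply/le_anti/andP.
by subst r; exists w => //=; rewrite uw // wv.
Qed.

Lemma row_preserved c i j k l : c (i, k) = Some (j, l) -> i = j.
Proof.
(* Upward induction: a domain point in the row just below is sent strictly lower than row [j], and
   by induction not below its own row. *)
have le_row m : forall i k j l, nat_of_ord i = m -> c (i, k) = Some (j, l) ->
    (m <= j)%N.
  elim: m => // m IHm {}i {}k {}j {}l im ci.
  have m_lt : (m < n)%N by rewrite -ltnS -im ltnW // ltnS ltn_ord.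
  have [k' [[j' l'] ci']] := row_meets_dom c (Ordinal m_lt).
  have : j' < j by apply: row_lt ci' ci _; rewrite ltEord /= im.
  by rewrite ltEord; apply: leq_ltn_trans; apply: IHm ci'.
(* The symmetric induction from the top row; [m] counts the rows above [i]. *)
have ge_row m : forall i k j l, (i + m).+1 = n -> c (i, k) = Some (j, l) ->
    (j <= i)%N.
  elim: m => [|m IHm] {}i {}k {}j {}l im ci.
    by have := ltn_ord j; lia.
  have m_lt : (i.+1 < n)%N by lia.
  have [k' [[j' l'] ci']] := row_meets_dom c (Ordinal m_lt).
  have := IHm (Ordinal m_lt) k' j' l' ltac:(move=> /=; lia) ci'.
  have : j < j' by apply: row_lt ci ci' _; rewrite ltEord /=.
  by rewrite ltEord /=; lia.
move=> ci; apply/val_inj/eqP; rewrite /= eqn_leq (le_row _ _ _ _ _ erefl ci).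
by apply: (ge_row (n - i.+1)%N _ _ _ _ _ ci); have := ltn_ord i; lia.
Qed.

End Rows.

Section Sigma.
Variables (n : nat) (i : 'I_n).
Implicit Types a b c : IO_Zlex n.

(** An idempotent is a partial identity, so this factor only discards values in row [i] outside the
    domain of [e]. *)
Lemma mul_circ_SomeP a (e : IO_Z) x y : e * e = e ->
  (a * of_power (circ i e)) x = Some y <->
  a x = Some y /\ (y.1 = i -> pdom e y.2).
Proof.
move=> ee; split.
  move=> /IOinf_mul_SomeP[z az] /of_power_SomeP[].
  case: z y az => [p k] [q l] /= az <-; rewrite ffunE.
  case: eqP => [_ ek|npi [<-]]; last by split=> [|/npi].
  by have := IOinf_idem_fix ee ek => ekl; subst l; split=> // _; exists k.
case: y => [q l] [ax dom_l]; apply/IOinf_mul_SomeP; exists (q, l) => //.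
apply/of_power_SomeP; split=> //=; rewrite ffunE.
case: eqP => // /dom_l [m em].
by rewrite em -(IOinf_idem_fix ee em).
Qed.

(** [F] restricts values, not arguments, because the idempotent in [sigma] acts after [a] and
    [b]. *)
Definition agree_off (F : set int) a b : Prop :=
  forall x y, ~ (y.1 = i /\ F y.2) -> a x = Some y <-> b x = Some y.

(** Finite sets and idempotents correspond: take [F] to be the complement of the domain of [e], and
    conversely [e] to be the identity off [F]. *)
Lemma sigmaP a b :
  sigma i a b <-> exists2 F : set int, finite_set F & agree_off F a b.
Proof.
split=> [[e ee ab]|[F finF ab]].
  exists (~` pdom e); first exact: IOinf_dom.
  move=> x y Ny.
  have dom_y : y.1 = i -> pdom e y.2.
    by move=> yi; apply: contrapT => Ndom; apply: Ny.
  have [h1 h2] := mul_circ_SomeP a x y ee.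
  have [h3 h4] := mul_circ_SomeP b x y ee.
  rewrite ab in h1 h2.
  by split=> h; [case/h2/h3: (conj h dom_y) | case/h4/h1: (conj h dom_y)].
have ee := IOinf_off_idem finF.
have off y : (y.1 = i -> pdom (IOinf_off finF) y.2) -> ~ (y.1 = i /\ F y.2).
  by move=> dom_y [/dom_y[z] /pid_off_SomeP[_ NF]].
exists (IOinf_off finF) => //; apply: IOinf_eqP => x y.
by split=> /(mul_circ_SomeP _ _ _ ee)[h dom_y]; apply/(mul_circ_SomeP _ _ _ ee);
  split=> //; apply/(ab _ _ (off _ dom_y)).
Qed.

Lemma sigma_equivalence : Equivalence (@sigma n i).
Proof.
split.
- by move=> a; exists 1; rewrite ?mulg1.
- by move=> a b [e ee ab]; exists e.
- move=> a b c /sigmaP[F finF ab] /sigmaP[G finG bc]; apply/sigmaP.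
  exists (F `|` G); first by rewrite finite_setU.
  move=> x y Ny; apply: (iff_trans (B := b x = Some y)).
    by apply: ab => -[yi Fy]; apply: Ny; split=> //; left.
  by apply: bc => -[yi Gy]; apply: Ny; split=> //; right.
Qed.

Lemma sigma_mull c a b : sigma i a b -> sigma i (c * a) (c * b).
Proof. by case=> e ee ab; exists e; rewrite // -!mulgA ab. Qed.

Lemma sigma_mulr c a b : sigma i a b -> sigma i (a * c) (b * c).
Proof.
move=> /sigmaP[F finF ab]; apply/sigmaP.
(* The image under [c] of the copy of [F] in row [i]; the preimage by [Some] drops undefined
   values. *)
pose img : set ('I_n *l int) :=
  Some @^-1` (pmap_of c @` ((fun k => (i, k) : 'I_n *l int) @` F)).
exists (snd @` img).
  apply: finite_image; apply: finite_preimage; last by do 2 apply: finite_image.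
  by move=> x y _ _ [].
(* An exceptional [y] would have an exceptional image [z]: row preservation keeps [z] in row [i]. *)
have off y z : c y = Some z -> ~ (z.1 = i /\ (snd @` img) z.2) ->
    ~ (y.1 = i /\ F y.2).
  case: y z => [p k] [q l] cy Nz [/= pi Fk]; subst p.
  apply: Nz; split=> /=; first exact/esym/(row_preserved cy).
  by exists (q, l) => //; exists (i, k) => //; exists k.
by move=> x z Nz; split=> /IOinf_mul_SomeP[y xy cy]; apply/IOinf_mul_SomeP;
  exists y => //; apply/(ab _ _ (off _ _ cy Nz)).
Qed.

End Sigma.

Theorem proposition2p11 (n : nat) (n_gt0 : (0 < n)%N) (i : 'I_n) :
  congruence (@sigma n i).
Proof.
split; [exact: sigma_equivalence | exact: sigma_mull | exact: sigma_mulr].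
Qed.
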